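(* Let $X=-N$, where $(N_t)_{t\ge0}$ is a Poisson process with constant intensity $a>0$, and let $V=ve^{-N}$, $v>0$. Put $\psi(1)=a(e^{-1}-1)$. Then: 1. The smallest optimal stopping time is $\tau^*(c)=\inf\{t\ge0:\ V_t\le B_c\}$, where $$B_c=\frac{ce(r-\psi(1))}{\alpha(er+ea-a)}.$$ 2. For $v>B_c$, the value function $w$ is equal to $$w(v)=\sum_{i\ge1}\left[\frac{\alpha v}{r-\psi(1)}\left(1-\left(\frac{a}{e(r+a)}\right)^i\right)-\frac cr\left(1-\left(\frac{a}{r+a}\right)^i\right)\right]\mathbf 1_{\{B_ce^{i-1}<v\le B_ce^i\}}.$$
   Context: The constants satisfy $r>0,\alpha>0,c>0$; $e$ is Euler's number. $\mathcal F^V$ is the right-continuous complete filtration generated by $V$ and $\Delta$ is the set of $\mathcal F^V$-stopping times (possibly infinite). $\mathbb P_v,\mathbb E_v$ denote probability and expectation given $V_0=v$. The optimal stopping problem and its value function are $$w(v)=\sup_{\tau\in\Delta}\mathbb E_v\left[\int_0^\tau e^{-rs}(\alpha V_s-c)\,ds\right].$$ A stopping time is optimal if it attains this supremum; the smallest optimal stopping time is the optimal $\tau^*$ with $\mathbb P_v(\tau^*\le\tau)=1$ for every optimal $\tau$. *)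

(* Defs.v *)
From HB Require Import structures.
From mathcomp Require Import all_boot all_order all_algebra.
From mathcomp Require Import all_classical all_reals all_analysis.

Set Implicit Arguments.
Unset Strict Implicit.
Unset Printing Implicit Defensive.

Import Order.TTheory GRing.Theory Num.Theory.
Import numFieldNormedType.Exports.

Local Open Scope classical_set_scope.
Local Open Scope ring_scope.

(* Time is the half-line [0, +oo[ of R: a process is indexed by R, and its
   values at negative times play no role. *)

Section poisson_process.
Context {d : measure_display} {T : measurableType d} {R : realType}.
Variable P : probability T R.

(* The subtraction is truncated, but it is only applied to processes with
   nondecreasing paths at times s <= t. *)
Definition increment (N : R -> T -> nat) (s t : R) (x : T) : nat :=
  (N t x - N s x)%N.

(* Each B i may be setT, so the product rule covers all subfamilies. *)
Definition independent_increments (N : R -> T -> nat) : Prop :=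
  forall (n : nat) (t : nat -> R) (B : nat -> set nat),
    0 <= t 0%N -> (forall i, t i <= t i.+1) ->
    (P (\bigcap_(i in `I_n) (increment N (t i) (t i.+1) @^-1` B i)) =
     \prod_(i < n) P (increment N (t i) (t i.+1) @^-1` B i))%E.

Record poisson_process (a : R) (N : R -> T -> nat) : Prop := PoissonProcess {
  poisson_measurable : forall t, 0 <= t -> measurable_fun setT (N t) ;
  poisson_start : forall x, N 0 x = 0%N ;
  poisson_nondecreasing :
    forall x s t, 0 <= s -> s <= t -> (N s x <= N t x)%N ;
  poisson_right_continuous : forall x t, 0 <= t ->
    (N s x)%:R @[s --> t^'+] --> ((N t x)%:R : R) ;
  poisson_independent : independent_increments N ;
  poisson_law : forall s t k, 0 <= s -> s < t ->
    P (increment N s t @^-1` [set k]) = (poisson_pmf (a * (t - s)) k)%:E }.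

End poisson_process.

Section optimal_stopping.
Context {d : measure_display} {T : measurableType d} {R : realType}.
Variable P : probability T R.
Implicit Types (V : R -> T -> R) (tau sigma : T -> \bar R).

Definition past_events V (t : R) : set (set T) :=
  [set A | exists s (B : set R),
     [/\ 0 <= s, s <= t, measurable B & A = V s @^-1` B]].

(* Usual augmentation of the filtration generated by V. *)
Definition usual_filtration V (t : R) : set (set T) :=
  \bigcap_(u in [set u | t < u]) <<s past_events V u `|` P.-negligible >>.

Definition stopping_time V tau : Prop :=
  (forall x, 0%E <= tau x)%E /\
  (forall t : R, 0 <= t ->
     usual_filtration V t [set x | (tau x <= t%:E)%E]).

Section reward.
Variables (r alpha c : R).

Definition running_reward V tau (x : T) : R :=
  \int[lebesgue_measure]_(s in [set s : R | 0 <= s /\ (s%:E <= tau x)%E])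
    (expR (- r * s) * (alpha * V s x - c)).

Definition expected_reward V tau : \bar R := 'E_P[running_reward V tau]%E.

Definition stopping_value V : \bar R :=
  ereal_sup [set expected_reward V tau | tau in stopping_time V].

Definition optimal_stopping_time V tau : Prop :=
  stopping_time V tau /\ expected_reward V tau = stopping_value V.

Definition smallest_optimal_stopping_time V tau : Prop :=
  optimal_stopping_time V tau /\
  forall sigma, optimal_stopping_time V sigma ->
    P [set x | (tau x <= sigma x)%E] = 1%E.

End reward.

Definition first_passage_below V (B : R) (x : T) : \bar R :=
  ereal_inf [set t%:E | t in [set t : R | 0 <= t /\ V t x <= B]].

End optimal_stopping.

Section poisson_model.
Context {d : measure_display} {T : measurableType d} {R : realType}.

Definition exp_neg_poisson (N : R -> T -> nat) (v t : R) (x : T) : R :=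
  v * expR (- (N t x)%:R).

Definition psi1 (a : R) : R := a * (expR (- 1) - 1).

Definition stopping_level (r alpha c a : R) : R :=
  c * expR 1 * (r - psi1 a) / (alpha * (expR 1 * r + expR 1 * a - a)).

Definition value_term (r alpha c a v : R) (i : nat) : R :=
  let B := stopping_level r alpha c a in
  (alpha * v / (r - psi1 a) * (1 - (a / (expR 1 * (r + a))) ^+ i)
   - c / r * (1 - (a / (r + a)) ^+ i))
  * \1_(`]B * expR 1 ^+ i.-1, B * expR 1 ^+ i]) v.

End poisson_model.

(* Main.v *)
(* Since e (r - psi1 a) = e r + e a - a, the level B is c / alpha.  The paths of
   V are nonincreasing, so the running payoff alpha V - c is positive before V
   first reaches ]-oo, B] and nonpositive afterwards: stopping at that passage
   maximizes the reward path by path.  Stopping at sigma instead loses at least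
   the discounted time spent in ]sigma, tau[ times the least positive payoff,
   so that an optimal sigma is almost surely at least tau.  If v > B the passage
   occurs at the k-th jump, with B e^(k-1) < v <= B e^k, and by Tonelli w v is
     sum_(i < k) (alpha v e^-i - c) int_0^oo e^(-r s) P(N_s = i) ds,
   with Erlang integrals a^i / (r + a)^(i + 1). *)
Require Import Defs.
From mathcomp Require Import all_boot all_order all_algebra.
From mathcomp Require Import all_classical all_reals all_analysis.
From mathcomp Require Import measurable_realfun ring lra.

Set Implicit Arguments.
Unset Strict Implicit.
Unset Printing Implicit Defensive.

Import Order.TTheory GRing.Theory Num.Theory.
Import numFieldNormedType.Exports.

Local Open Scope classical_set_scope.
Local Open Scope ring_scope.

(** * Integral comparison and Erlang integrals *)

(** Positive and negative parts are integrated as suprema over simple functions below them, which is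
    monotone even without measurability. This allows rewards to be compared path by path. *)
Lemma le_integral_nonmeasurable d (T : measurableType d) (R : realType)
    (mu : {measure set T -> \bar R}) (f g : T -> \bar R) :
  (forall x, f x <= g x)%E -> (\int[mu]_x f x <= \int[mu]_x g x)%E.
Proof.
move=> fg; rewrite (integralE _ _ f) (integralE _ _ g); apply: leeB.
  rewrite !ge0_integralTE; [|exact: funepos_ge0..].
  apply: ereal_sup_le => _ [h hf <-]; exists h => // x.
  exact/(le_trans (hf x))/(@funepos_le _ _ setT _ _ (fun y _ => fg y))/in_setT.
rewrite !ge0_integralTE; [|exact: funeneg_ge0..].
apply: ereal_sup_le => _ [h hf <-]; exists h => // x.
exact/(le_trans (hf x))/(@funeneg_le _ _ setT _ _ (fun y _ => fg y))/in_setT.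
Qed.

Lemma cvg_exprM_expRN (R : realType) n :
  (x ^+ n * expR (- x) : R) @[x --> +oo] --> (0 : R).
Proof.
apply/cvgr0Pnorm_le => e e0; near=> x.
have x0 : 0 < x by near: x; apply: nbhs_pinfty_gt; rewrite num_real.
rewrite ger0_norm ?mulr_ge0 ?expR_ge0 ?exprn_ge0 ?(ltW x0)//=.
(* Since [e^x >= x^(n+1) / (n+1)!], the quantity is at most [(n+1)! / x], hence this threshold. *)
have xe : n.+1`!%:R <= e * x.
  by rewrite -ler_pdivrMl//; near: x; apply: nbhs_pinfty_ge; rewrite num_real.
rewrite expRN ler_pdivrMr ?expR_gt0// -(ler_pM2r x0) -exprSr mulrAC.
apply: le_trans (ler_wpM2r (expR_ge0 x) xe).
rewrite -ler_pdivrMl ?ltr0n ?fact_gt0// mulrC.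
by apply: le_trans (expR_ge1Dxn n (ltW x0)); rewrite lerDr.
Unshelve. all: by end_near. Qed.

(** Up to the factor [- 1 / b], the antiderivative is a Poisson distribution function, whose
    derivative telescopes. *)
Lemma is_derive_erlang_tail (R : realType) (b : R) n (x : R) : b != 0 ->
  is_derive x 1
    (fun y => - (b^-1 *
       \sum_(j < n.+1) ((b * y) ^+ j / j`!%:R * expR (- (b * y)))))
    ((b * x) ^+ n / n`!%:R * expR (- (b * x))).
Proof.
move=> b0.
have dlin : is_derive x 1 (fun y : R => b * y) b.
  by apply: is_derive_eq; rewrite /GRing.scale/= mulr1.
have dexp : is_derive x 1 (fun y : R => expR (- (b * y))) (expR (- (b * x)) * - b).
  exact: (@is_derive1_comp _ expR (fun y : R => - (b * y)) x _ _
    (is_derive_expR _) (is_deriveN dlin)).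
elim: n => [|n IH].
  under eq_fun do rewrite big_ord_recr big_ord0 /= add0r expr0 fact0 divr1 mul1r.
  apply: is_derive_eq; rewrite /GRing.scale/= expr0 fact0; field => //.
have dX : is_derive x 1 (fun y : R => (b * y) ^+ n.+1) (n.+1%:R * (b * x) ^+ n * b).
  have -> : (fun y : R => (b * y) ^+ n.+1) = (fun y => b * y) ^+ n.+1.
    by apply/funext => y; rewrite exprfctE.
  exact: is_deriveX.
(* The second summand cancels the derivative given by the induction hypothesis. *)
have dT : is_derive x 1
    (fun y : R => - (b^-1 / n.+1`!%:R) * ((b * y) ^+ n.+1 * expR (- (b * y))))
    (- (b^-1 / n.+1`!%:R) * ((b * x) ^+ n.+1 * (expR (- (b * x)) * - b) +
                             expR (- (b * x)) * (n.+1%:R * (b * x) ^+ n * b))).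
  exact: (is_deriveZ _ (is_deriveM dX dexp)).
have := is_deriveD IH dT.
set g := _ + _; set h := (fun _ => _).
have -> : g = h.
  apply/funext => y; rewrite /g /h fctE [in RHS]big_ord_recr /= mulrDr opprD.
  by congr (_ + _); rewrite mulNr -!mulrA; congr (- (_ * _)); exact: mulrCA.

move/is_derive_eq; apply.
rewrite factS natrM; field.
by rewrite b0 nat1r !pnatr_eq0 -lt0n fact_gt0.
Qed.

(** Normalisation of the Erlang density: the antiderivative tends to 0 at infinity, and at 0 only
    its term [j = 0] survives. *)
Lemma integral_erlang (R : realType) (b : R) n : 0 < b ->
  (\int[lebesgue_measure]_(x in `[0%R, +oo[)
     ((b * x) ^+ n / n`!%:R * expR (- (b * x)))%:E = b^-1%:E)%E.
Proof.
move=> b0; have dF x := is_derive_erlang_tail n x (lt0r_neq0 b0).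
rewrite (@ge0_continuous_FTC2y _ _ (fun y => - (b^-1 *
  \sum_(j < n.+1) ((b * y) ^+ j / j`!%:R * expR (- (b * y))))) _ 0).
- rewrite mulr0 big_ord_recl big1 => [|i _]; last by rewrite exprS !mul0r.
  rewrite /= -EFinB expr0 fact0 oppr0 expR0; congr EFin; field; exact: lt0r_neq0.
- move=> x x0; have bx : 0 <= b * x by rewrite mulr_ge0// ltW.
  by rewrite mulr_ge0 ?expR_ge0// divr_ge0 ?exprn_ge0.
- apply: continuous_subspaceT => x.
  apply: (@continuousM _ R^o (fun y => (b * y) ^+ n / n`!%:R)
                             (fun y => expR (- (b * y)))).
    apply: cvgMr_tmp.
    apply: (@continuous_comp R^o R^o R^o (fun y => b * y) (fun u => u ^+ n)).
      exact: mulrl_continuous.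
    exact: exprn_continuous.
  apply: (@continuous_comp R^o R^o R^o (fun y => - (b * y)) expR).
    by apply: (@continuousN _ R^o); exact: mulrl_continuous.
  exact: continuous_expR.
- rewrite -[X in _ --> X]oppr0 -[X in - X](mulr0 b^-1); apply: cvgN; apply: cvgMl_tmp.
  elim: n.+1 => [|m IH]; first by under eq_fun do rewrite big_ord0; exact: cvg_cst.
  under eq_fun do rewrite big_ord_recr /=.
  rewrite -(addr0 (0 : R)); apply: cvgD => //; rewrite ?addr0 //.
  rewrite (_ : (fun _ => _) =
    (fun u => m`!%:R^-1 * (u ^+ m * expR (- u))) \o (fun x => b * x)); last first.
    by apply/funext => x /=; rewrite mulrCA mulrA.
  apply: (@cvg_comp _ _ _ _ _ _ (pinfty_nbhs R)); first exact: gt0_cvgMry.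
  rewrite -(mulr0 m`!%:R^-1); apply: cvgMl_tmp; exact: cvg_exprM_expRN.
- by move=> x _; exact: ex_derive.
- apply/cvg_at_right_filter; have /derivable1_diffP := @ex_derive _ _ _ _ _ _ _ (dF 0).
  exact: differentiable_continuous.
- by move=> x _; rewrite derive1E; apply: derive_val.
Qed.

(** * Paths and marginal laws of the Poisson process *)

Section poisson_paths.
Context {d : measure_display} {T : measurableType d} {R : realType}.
Variables (P : probability T R) (a : R) (N : R -> T -> nat).
Hypothesis a_gt0 : 0 < a.
Hypothesis N_poisson : poisson_process P a N.

Lemma poisson_lt_right x t k : 0 <= t -> (N t x < k)%N ->
  exists2 u, t < u & (N u x < k)%N.
Proof.
move=> t0 Ntk.
have /cvgrPdist_lt /(_ _ ltr01) :=
  @poisson_right_continuous _ _ _ _ _ _ N_poisson x t t0.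
move=> /(filterI (nbhs_right_gt t)) /filter_ex [u /= [tu Nut]].
exists u => //; apply: leq_ltn_trans Ntk.
have Ntu : (N t x <= N u x)%N.
  by apply: (poisson_nondecreasing N_poisson) => //; exact: ltW.
(* Natural numbers at distance less than 1 coincide. *)
by move: Nut; rewrite distrC -natrB// normr_nat ltrn1 ltnS leqn0 subn_eq0.
Qed.

Lemma poisson_prob s i : 0 <= s ->
  P (N s @^-1` [set i]) = ((a * s) ^+ i / i`!%:R * expR (- (a * s)))%:E.
Proof.
(* [poisson_law] concerns [s < t] only; at time 0 the law is the point mass given by
   [poisson_start]. *)
rewrite le_eqVlt => /predU1P[<-|s0].
  rewrite mulr0 oppr0 expR0 mulr1 expr0n; case: i => [|i].
    rewrite fact0 divr1 (_ : _ @^-1` _ = setT) ?probability_setT//.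
    by apply/seteqP; split => // x _ /=; exact: poisson_start N_poisson x.
  rewrite mul0r (_ : _ @^-1` _ = set0) ?measure0//.
  by apply/seteqP; split => // x /=; rewrite (poisson_start N_poisson).
have := @poisson_law _ _ _ _ _ _ N_poisson 0 s i (lexx 0) s0.
rewrite /poisson_pmf subr0 mulr_gt0// => <-; congr (P _).
by apply/seteqP; split => x /=; rewrite /increment (poisson_start N_poisson) subn0.
Qed.

(** By right continuity and monotonicity, there are fewer than [k] jumps at [s] iff there are fewer
    than [k] at some nonnegative rational time after [s]. These sets are thus countable unions of
    rectangles, and the level sets are their differences. *)
Lemma measurable_poisson_extension :
  measurable_fun setT (fun z : T * R => N (Num.max 0 z.2) z.1).
Proof.
pose X (z : T * R) := N (Num.max 0 z.2) z.1.
have mlt k : measurable [set z | (X z < k)%N].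
  rewrite [X in measurable X](_ : _ = \bigcup_(q in [set q : rat | 0 <= q])
      ((N (ratr q) @^-1` [set i | (i < k)%N]) `*` `]-oo, ratr q[%classic)).
    rewrite bigcup_mkcond; apply: bigcupT_measurable_rat => q.
    case: ifPn => // /set_mem q0; apply: measurableX => //.
    rewrite -[X in measurable X]setTI.
    by apply: (poisson_measurable N_poisson); rewrite ?ler0q.
  apply/seteqP; split => [[x s] /= Xk|[x s] [q /= q0 [/= Nqk]]].
    have [|u su Nuk] := @poisson_lt_right x (Num.max 0 s) k _ Xk.
      by rewrite le_max lexx.
    have [q /[!in_itv]/= /andP[sq qu]] := rat_in_itvoo su.
    move: (sq); rewrite gt_max => /andP[q0 sq'].
    exists q; first by rewrite /= -(ler0q R) ltW.
    split => /=; last by rewrite in_itv.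
    by apply: leq_ltn_trans Nuk; apply: (poisson_nondecreasing N_poisson); apply: ltW.
  rewrite in_itv/= => sq; apply: leq_ltn_trans Nqk.
  apply: (poisson_nondecreasing N_poisson); first by rewrite le_max lexx.
  by rewrite ge_max ler0q q0 ltW.
move=> _ B _; rewrite setTI.
rewrite [X in measurable X](_ : _ = \bigcup_(i in B) [set z | X z = i]).
  apply: bigcup_measurable => i _.
  rewrite [X in measurable X](_ : _ =
      [set z | (X z < i.+1)%N] `\` [set z | (X z < i)%N]).
    exact: measurableD.
  apply/seteqP; split => z; rewrite /setD /=.
    by move=> Xi; rewrite Xi ltnS leqnn; split => //; rewrite ltnn.
  rewrite ltnS => -[Xi /negP]; rewrite -leqNgt => iX.
  by apply/eqP; rewrite eqn_leq Xi.
by apply/seteqP; split => [z Bz|z [i Bi /= Xi]]; [exists (X z)|rewrite /= -/(X z) Xi].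
Qed.

End poisson_paths.

(** The exponential density carries the discount and vanishes at negative times, so the time
    integrals below can run over the whole line. *)
Lemma integrable_exponential_pdfM (R : realType) (r M : R) (q : R -> R) :
  0 < r -> measurable_fun setT q -> (forall s, `|q s| <= M) ->
  lebesgue_measure.-integrable setT (EFin \o (fun s => exponential_pdf r s * q s)).
Proof.
move=> r0 mq qM.
apply: (integrableMl measurableT (integrable_exponential_pdf r0) mq).
exists M; split; first exact: num_real.
by move=> M' MM' s _ /=; apply: le_trans (qM s) (ltW MM').
Qed.

(** * First passage as a jump time, and measurability of stopping times *)

Section first_passage.
Context {d : measure_display} {T : measurableType d} {R : realType}.
Variables (P : probability T R) (a v B : R) (N : R -> T -> nat) (k : nat).
Hypothesis P_complete : measure_is_complete P.
Hypothesis N_poisson : poisson_process P a N.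
(** The level enters only through [k], the number of jumps that first brings [V] to [B] or below;
    [k = 0] if [v <= B]. *)
Hypothesis levelP : forall n : nat, (v * expR (- n%:R) <= B) = (k <= n)%N.
Let V := exp_neg_poisson N v.

(** If [N s x < k], right continuity keeps this true up to some [u > s], which bounds the infimum
    from below; otherwise [s] itself belongs to the set of passage times. *)
Lemma lt_first_passage s x : 0 <= s ->
  (s%:E < first_passage_below V B x)%E = (N s x < k)%N.
Proof.
move=> s0; have [Nk|Nk] := ltnP (N s x) k.
  have [u su Nuk] := poisson_lt_right N_poisson s0 Nk.
  rewrite (@lt_le_trans _ _ u%:E) ?lte_fin//.
  apply: le_ereal_inf_tmp => _ [t [t0 Vt] <-]; rewrite lee_fin leNgt.
  apply/negP => tu; move: Vt; rewrite /V /exp_neg_poisson levelP leqNgt.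
  rewrite (leq_ltn_trans _ Nuk)//.
  by apply: (poisson_nondecreasing N_poisson) => //; exact: ltW.
apply/negbTE; rewrite -leNgt; apply: ereal_inf_lbound.
by exists s => //; split => //; rewrite /V /exp_neg_poisson levelP.
Qed.

Lemma first_passage_ge0 x : (0 <= first_passage_below V B x)%E.
Proof. by apply: le_ereal_inf_tmp => _ [t [t0 _] <-]; rewrite lee_fin. Qed.

(** As paths are nonincreasing, passage by time [t] is the event [V t <= B], which belongs to the
    past of every [u > t]. *)
Lemma stopping_time_first_passage :
  stopping_time P V (first_passage_below V B).
Proof.
split=> [x|t t0]; first exact: first_passage_ge0.
move=> u /= tu; apply: sub_sigma_algebra; left.
exists t, `]-oo, B]%classic; split => //; first exact: ltW.
apply/seteqP; split=> x /=;
  by rewrite in_itv/= /V /exp_neg_poisson levelP leqNgt -lt_first_passage// -leNgt.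
Qed.

(** Completeness makes the negligible generators of the filtration measurable; the others are
    preimages under the measurable [V s]. *)
Lemma measurable_stopping_time (sigma : T -> \bar R) :
  stopping_time P V sigma -> measurable_fun [set: T] sigma.
Proof.
move=> [sigma0 Fsigma].
apply: (measurability (@ErealGenOInfty.G R)).
  exact: ErealGenOInfty.measurableE.
move=> /= _ [_ [t ->] <-]; rewrite setTI.
rewrite [X in measurable X](_ : _ = ~` [set x | (sigma x <= t%:E)%E]); last first.
  by apply/seteqP; split => x /=; rewrite in_itv/= andbT ltNge => /negP.
apply: measurableC; have [t0|t0] := ltP t 0.
  rewrite (_ : [set _ | _] = set0)//; apply/seteqP; split => // x /=.
  by apply/negP; rewrite -ltNge (lt_le_trans _ (sigma0 x))// lte_fin.
have := Fsigma t t0 (t + 1); rewrite /= ltrDl => /(_ ltr01).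
apply: smallest_sub; first exact: sigma_algebra_measurable.
move=> A [[s [C [s0 _ mC ->]]]|]; last exact: P_complete.
rewrite -[X in measurable X]setTI.
have : measurable_fun setT (V s); last exact.
apply: measurable_funM => //; apply: measurableT_comp => //.
apply: measurableT_comp => //; apply: measurableT_comp => //.
exact: (poisson_measurable N_poisson).
Qed.

End first_passage.

Lemma indic_bool (U : Type) (R : pzRingType) (b : U -> bool) x :
  \1_[set y | b y] x = (b x)%:R :> R.
Proof.
rewrite indicE; case: (boolP (b x)) => bx; first by rewrite mem_set.
by rewrite memNset//; exact/negP.
Qed.

(** * Pathwise rewards and their comparison with first passage *)

Section optimal_stopping_poisson.
Context {d : measure_display} {T : measurableType d} {R : realType}.
Variables (P : probability T R) (r alpha c a v : R) (N : R -> T -> nat) (k : nat).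
Hypothesis P_complete : measure_is_complete P.
Hypothesis N_poisson : poisson_process P a N.
Hypotheses (r_gt0 : 0 < r) (alpha_gt0 : 0 < alpha) (c_gt0 : 0 < c).
Hypotheses (a_gt0 : 0 < a) (v_gt0 : 0 < v).
Hypothesis levelP : forall n : nat, (v * expR (- n%:R) <= c / alpha) = (k <= n)%N.

Let V := exp_neg_poisson N v.
Let tau := first_passage_below V (c / alpha).
(* N is only controlled at nonnegative times: X extends it by N 0 = 0. *)
Let X (z : T * R) : nat := N (Num.max 0 z.2) z.1.
(* The factor 1 / r turns the density r e^(-r s) into the discount e^(-r s). *)
Let gain (n : nat) : R := r^-1 * (alpha * (v * expR (- n%:R)) - c).

Let gain_gt0 n : (n < k)%N -> 0 < gain n.
Proof.
rewrite ltnNge -levelP -ltNge ltr_pdivrMr// mulrC => ng.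
by rewrite mulr_gt0 ?invr_gt0// subr_gt0.
Qed.

Let gain_le0 n : (k <= n)%N -> gain n <= 0.
Proof.
rewrite -levelP ler_pdivlMr// mulrC => ng.
by rewrite mulr_ge0_le0 ?invr_ge0 ?(ltW r_gt0)// subr_le0.
Qed.

Let gain_bound n : `|gain n| <= r^-1 * (alpha * v + c).
Proof.
have e0 := expR_gt0 (- n%:R : R).
have e1 : expR (- n%:R) <= 1 :> R by rewrite expR_le1 oppr_le0.
have h : v * expR (- n%:R) <= v by rewrite ler_piMr// ltW.
have h0 : 0 <= alpha * (v * expR (- n%:R)) by rewrite !mulr_ge0// ltW.
have h1 : alpha * (v * expR (- n%:R)) <= alpha * v by rewrite ler_pM2l.
rewrite /gain normrM gtr0_norm ?invr_gt0// ler_pM2l ?invr_gt0// ler_norml.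
have avE := le_trans h0 h1.
rewrite opprD lerD2r (le_trans _ h0) ?oppr_le0//=.
by rewrite lerD// (le_trans _ (ltW c_gt0))// oppr_le0 ltW.
Qed.

(** [gain] decreases in [n], so its least value before passage is at [k - 1]; for [k = 0] the bound
    is vacuous and 1 serves. *)
Let gain_min : exists2 D, 0 < D & forall n, (n < k)%N -> D <= gain n.
Proof.
have [->|k0] := posnP k; first by exists 1.
exists (gain k.-1) => [|n nk]; first by rewrite gain_gt0// prednK.
rewrite ler_pM2l ?invr_gt0// lerD2r ler_pM2l// ler_pM2l// ler_expR lerN2 ler_nat.
by rewrite -ltnS prednK.
Qed.

Let measurable_X : measurable_fun setT X.
Proof. exact: measurable_poisson_extension N_poisson. Qed.

Let measurable_natfun (f : nat -> R) : measurable_fun setT f.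
Proof. by []. Qed.

(** Integrands against the exponential density: the gain up to [sigma], the gain before the [k]-th
    jump, and a constant [D] on the times after [sigma] but before that jump. *)
Let running (sigma : T -> \bar R) (z : T * R) : R :=
  gain (X z) * (z.2%:E <= sigma z.1)%E%:R.
Let stopped (z : T * R) : R := gain (X z) * (X z < k)%N%:R.
Let lost D (sigma : T -> \bar R) (z : T * R) : R :=
  D * ((sigma z.1 < z.2%:E)%E && (X z < k)%N)%:R.

Let measurable_running sigma x :
  measurable_fun [set: R] (fun s => running sigma (x, s)).
Proof.
apply: measurable_funM.
  apply: (measurableT_comp (measurable_natfun gain)).
  exact: measurableT_comp measurable_X (pair1_measurable x).
rewrite (_ : (fun _ => _) = \1_[set s : R | (s%:E <= sigma x)%E]).
  apply: measurable_indic; rewrite -[X in measurable X]setTI.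
  exact: emeasurable_fun_infty_c.
by apply/funext => s; rewrite indic_bool.
Qed.

Let measurable_stopped : measurable_fun [set: T * R] stopped.
Proof.
apply: measurable_funM.
  exact: (measurableT_comp (measurable_natfun gain) measurable_X).
exact: (measurableT_comp (measurable_natfun (fun n => (n < k)%N%:R)) measurable_X).
Qed.

Let measurable_lost D sigma : measurable_fun [set: T] sigma ->
  measurable_fun [set: T * R] (lost D sigma).
Proof.
move=> msigma.
rewrite (_ : lost D sigma = (fun z => D *
    (\1_[set z : T * R | (sigma z.1 < z.2%:E)%E] z * (X z < k)%N%:R))).
  apply: measurable_funM => //; apply: measurable_funM.
    apply: measurable_indic; rewrite -[X in measurable X]setTI.
    apply: measurable_lte => //.
      exact: (measurableT_comp msigma measurable_fst).
    by apply: (measurable_EFinP _ (snd : T * R -> R)).2; exact: measurable_snd.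
  exact: (measurableT_comp (measurable_natfun (fun n => (n < k)%N%:R)) measurable_X).
apply/funext => z; rewrite /lost.
rewrite (indic_bool _ (fun z : T * R => (sigma z.1 < z.2%:E)%E)).
by rewrite -natrM mulnb.
Qed.

Let norm_indic_le (b : bool) (y M : R) : `|y| <= M -> `|y * b%:R| <= M.
Proof.
by case: b => yM; rewrite ?mulr1// mulr0 normr0 (le_trans (normr_ge0 y)).
Qed.

Let integrable_running sigma x : lebesgue_measure.-integrable setT
  (EFin \o (fun s => exponential_pdf r s * running sigma (x, s))).
Proof.
apply: (integrable_exponential_pdfM r_gt0 (measurable_running sigma x)) => s.
exact: norm_indic_le (gain_bound _).
Qed.

Let integrable_stopped x : lebesgue_measure.-integrable setT
  (EFin \o (fun s => exponential_pdf r s * stopped (x, s))).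
Proof.
apply: (integrable_exponential_pdfM r_gt0
  (measurableT_comp measurable_stopped (pair1_measurable x))) => s.
exact: norm_indic_le (gain_bound _).
Qed.

Let integrable_lost D sigma x : measurable_fun [set: T] sigma ->
  lebesgue_measure.-integrable setT
    (EFin \o (fun s => exponential_pdf r s * lost D sigma (x, s))).
Proof.
move=> msigma.
apply: (integrable_exponential_pdfM r_gt0
  (measurableT_comp (measurable_lost D msigma) (pair1_measurable x))) => s.
exact: norm_indic_le (lexx _).
Qed.

(** The density removes negative times, and its factor [r] cancels the [1 / r] in [gain]. *)
Let running_rewardE sigma x : running_reward r alpha c V sigma x =
  \int[lebesgue_measure]_s (exponential_pdf r s * running sigma (x, s)).
Proof.
rewrite /running_reward Rintegral_mkcond; apply: eq_Rintegral => s _.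
rewrite patchE /running /=; have [s0|s0] := ltP s 0.
  rewrite lt0_exponential_pdf// mul0r memNset//= => -[].
  by rewrite leNgt s0.
rewrite exponential_pdfE//; case: (boolP (_ <= sigma x)%E) => h.
  rewrite mem_set// mulr1 /gain /X /= max_r//.
  by rewrite /V /exp_neg_poisson; field; exact: lt0r_neq0.
by rewrite mulr0 mulr0 memNset//= => -[_]; exact/negP.
Qed.

Let reward_stopped x : running_reward r alpha c V tau x =
  \int[lebesgue_measure]_s (exponential_pdf r s * stopped (x, s)).
Proof.
rewrite running_rewardE; congr fine; apply: ae_eq_integral => //.
- exact: measurable_int (integrable_running tau x).
- exact: measurable_int (integrable_stopped x).
(* The conditions [s <= tau] and [s < tau] differ at one point only. For infinite [tau], [fine]
   returns 0, a harmless extra point. *)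
exists [set fine (tau x)]; split.
- exact: measurable_set1.
- exact: lebesgue_measure_set1.
move=> s /= sx; apply: contrapT => sN; apply: sx => _; congr EFin.
have [s0|s0] := ltP s 0; first by rewrite lt0_exponential_pdf// !mul0r.
rewrite /running /stopped /= /X /= max_r//.
rewrite -(lt_first_passage N_poisson levelP)// -/V -/tau le_eqVlt.
by case: eqP => // st; case: sN; rewrite /= -st.
Qed.

Let le_reward D sigma x : measurable_fun [set: T] sigma ->
  (forall n, (n < k)%N -> D <= gain n) ->
  running_reward r alpha c V sigma x +
    \int[lebesgue_measure]_s (exponential_pdf r s * lost D sigma (x, s)) <=
  running_reward r alpha c V tau x.
Proof.
move=> msigma Dgain; rewrite reward_stopped running_rewardE.
have iR := integrable_running sigma x; have iL := integrable_lost D x msigma.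
rewrite -RintegralD//; apply: le_Rintegral => //.
  exact: (integrableD _ iR iL).
move=> s _; rewrite -mulrDr; apply: ler_wpM2l.
  by rewrite exponential_pdf_ge0// ltW.
(* Before the [k]-th jump exactly one of [running] and [lost] is active, and [D] is at most the
   gain; afterwards the gain is nonpositive. *)
rewrite /running /lost /stopped /= ltNge.
case: (ltnP (X (x, s)) k) => Xk; case: (_ <= _)%E;
  rewrite /= ?(mulr1, mulr0, addr0, add0r)//.
  exact: Dgain.
exact: gain_le0.
Qed.

(** * Occupation times and the expected reward of first passage *)

Let occ i x : \bar R := (\int[lebesgue_measure]_s
  (exponential_pdf r s * (X (x, s) == i)%:R)%:E)%E.

Let measurable_weight (b : nat -> bool) : measurable_fun [set: T * R]
  (fun z => exponential_pdf r z.2 * (b (X z))%:R).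
Proof.
apply: measurable_funM.
  exact: (measurableT_comp (measurable_exponential_pdf r) measurable_snd).
exact: (measurableT_comp (measurable_natfun (fun n => (b n)%:R)) measurable_X).
Qed.

Let weight_ge0 (b : bool) s : (0 <= (exponential_pdf r s * b%:R)%:E)%E.
Proof. by rewrite lee_fin mulr_ge0// exponential_pdf_ge0// ltW. Qed.

Let occ_ge0 i x : (0 <= occ i x)%E.
Proof. by apply: integral_ge0. Qed.

(** This is the geometric law of the number of jumps before an independent exponential time of rate
    [r]. *)
Let occupation i :
  (\int[P]_x occ i x = (r / (r + a) * (a / (r + a)) ^+ i)%:E)%E.
Proof.
rewrite (@fubini_tonelli _ _ _ _ _ P lebesgue_measure
  (fun z => (exponential_pdf r z.2 * (X z == i)%:R)%:E)) /=; last 2 first.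
- by apply/measurable_EFinP; exact: (measurable_weight (pred1 i)).
- by move=> z; rewrite lee_fin mulr_ge0// exponential_pdf_ge0// ltW.
have ra0 : 0 < r + a by rewrite addr_gt0.
(* Writing [a s] as [a / (r + a)] times [(r + a) s] produces the Erlang integrand of rate
   [r + a]. *)
transitivity (\int[lebesgue_measure]_(s in `[0%R, +oo[)
   ((r * (a / (r + a)) ^+ i)%:E *
    (((r + a) * s) ^+ i / i`!%:R * expR (- ((r + a) * s)))%:E))%E.
  rewrite [RHS]integral_mkcond; apply: eq_integral => s _.
  rewrite patchE mem_setE; case: ifPn; rewrite in_itv/= andbT => s0; last first.
    rewrite lt0_exponential_pdf ?ltNge//.
    by under eq_integral do rewrite mul0r; rewrite integral0.
  have mNi : measurable (N s @^-1` [set i]).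
    by rewrite -[X in measurable X]setTI; apply: (poisson_measurable N_poisson).
  have XE x : (X (x, s) == i)%:R = \1_(N s @^-1` [set i]) x :> R.
    rewrite /X /= max_r// -(indic_bool R (fun y => N s y == i)).
    by congr (\1_ _ x); apply/seteqP; split => y /= /eqP.
  under eq_integral do rewrite XE EFinM.
  rewrite ge0_integralZl//; last 2 first.
  - exact/(measurable_EFinP _ (\1_(N s @^-1` [set i]))).2/measurable_indic.
  - by rewrite lee_fin exponential_pdf_ge0// ltW.
  rewrite integral_indic// setIT.
  rewrite -[X in (_ * X)%E]/(P (N s @^-1` [set i])).
  rewrite (poisson_prob a_gt0 N_poisson)// exponential_pdfE// -!EFinM; congr EFin.
  have -> : expR (- ((r + a) * s)) = expR (- r * s) * expR (- (a * s)).
    by rewrite -expRD mulrDl opprD mulNr.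
  rewrite !exprMn exprVn.
  have := expf_neq0 i (lt0r_neq0 ra0).
  have : i`!%:R != 0 :> R by rewrite pnatr_eq0 -lt0n fact_gt0.
  move: ((r + a) ^+ i) (a ^+ i) (s ^+ i) (i`!%:R : R) (expR _) (expR _).
  move=> x1 x2 x3 x4 x5 x6 x40 x10.
  by field; apply/andP.
rewrite ge0_integralZl//; last 3 first.
- apply/(measurable_EFinP _ (fun s => _)); apply: measurable_funM.
    apply: measurable_funM => //; apply: measurable_funX; exact: measurable_funM.
  apply: measurableT_comp => //; apply: measurable_funN; exact: measurable_funM.
- move=> s /=; rewrite in_itv/= andbT => s0.
  have bs : 0 <= (r + a) * s by rewrite mulr_ge0// ltW.
  by rewrite lee_fin mulr_ge0 ?expR_ge0// divr_ge0 ?exprn_ge0.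
- by rewrite lee_fin mulr_ge0 ?exprn_ge0 ?divr_ge0// ltW.
rewrite integral_erlang// -EFinM; congr EFin; ring.
Qed.

Let measurable_occ i : measurable_fun [set: T] (occ i).
Proof.
apply: (measurable_fun_fubini_tonelli_F (m2 := lebesgue_measure)
  (fun z => (exponential_pdf r z.2 * (X z == i)%:R)%:E)) => //=.
by apply/measurable_EFinP; exact: (measurable_weight (pred1 i)).
Qed.

(** Time before passage is split by the current number of jumps; the gains for [i < k] are positive,
    so nonnegative integration suffices. *)
Let reward_sum x : (running_reward r alpha c V tau x)%:E =
  (\sum_(i < k) (gain i)%:E * occ i x)%E.
Proof.
rewrite reward_stopped /Rintegral fineK; last first.
  exact: integrable_fin_num (integrable_stopped x).
transitivity (\int[lebesgue_measure]_s \sum_(i < k)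
    ((gain i)%:E * (exponential_pdf r s * (X (x, s) == i)%:R)%:E))%E.
  apply: eq_integral => s _; rewrite sumEFin; congr EFin.
  rewrite /stopped; have [Xk|Xk] := ltnP (X (x, s)) k.
    rewrite (bigD1 (Ordinal Xk))//= eqxx big1 ?addr0 => [|i].
      by rewrite !mulr1 mulrC.
    by rewrite -val_eqE /= eq_sym => /negbTE ->; rewrite !mulr0.
  rewrite big1 => [|i _]; first by rewrite !mulr0.
  by rewrite gtn_eqF ?mulr0// (leq_trans (ltn_ord i)).
have mw i : measurable_fun [set: R]
    (fun s => (exponential_pdf r s * (X (x, s) == i)%:R)%:E).
  apply/measurable_EFinP.
  exact: (measurableT_comp (measurable_weight (pred1 i)) (pair1_measurable x)).
rewrite ge0_integral_sum//.
- apply: eq_bigr => i _; rewrite ge0_integralZl//; first exact: mw.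
  by rewrite lee_fin ltW// gain_gt0.
- by move=> i; apply: measurable_funeM; exact: mw.
- by move=> i s _; rewrite mule_ge0// lee_fin ltW// gain_gt0.
Qed.

(** Gains before passage averaged over the geometric occupation law. *)
Definition poisson_value := \sum_(i < k) gain i * (r / (r + a) * (a / (r + a)) ^+ i).

Let integral_reward :
  (\int[P]_x (running_reward r alpha c V tau x)%:E = poisson_value%:E)%E.
Proof.
under eq_integral do rewrite reward_sum.
rewrite ge0_integral_sum//.
- rewrite -sumEFin; apply: eq_bigr => i _.
  by rewrite ge0_integralZl ?lee_fin ?(ltW (gain_gt0 _))// occupation.
- by move=> i; apply: measurable_funeM; exact: measurable_occ.
- by move=> i x _; rewrite mule_ge0// lee_fin ltW// gain_gt0.
Qed.

Let reward_ge0 x : 0 <= running_reward r alpha c V tau x.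
Proof.
rewrite -lee_fin reward_sum; apply: sume_ge0 => i _.
by rewrite mule_ge0// lee_fin ltW// gain_gt0.
Qed.

Let integrable_reward : P.-integrable setT (EFin \o running_reward r alpha c V tau).
Proof.
apply/integrableP; split.
  rewrite (_ : _ \o _ = fun x => (\sum_(i < k) (gain i)%:E * occ i x)%E); last first.
    by apply/funext => x; exact: reward_sum.
  by apply: emeasurable_sum => i; apply: measurable_funeM; exact: measurable_occ.
under eq_integral do rewrite /= ger0_norm//.
by rewrite integral_reward ltry.
Qed.

(** * Loss from stopping early, optimality and minimality *)

Let loss D sigma x : R :=
  \int[lebesgue_measure]_s (exponential_pdf r s * lost D sigma (x, s)).

Let weight_lost_ge0 D sigma z : 0 <= D ->
  (0 <= (exponential_pdf r z.2 * lost D sigma z)%:E)%E.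
Proof. by move=> D0; rewrite lee_fin !mulr_ge0// exponential_pdf_ge0// ltW. Qed.

Let loss_ge0 D sigma x : 0 <= D -> 0 <= loss D sigma x.
Proof.
move=> D0; apply: Rintegral_ge0 => s _; rewrite -lee_fin.
exact: (weight_lost_ge0 sigma (x, s) D0).
Qed.

Let EFin_loss D sigma x : measurable_fun [set: T] sigma ->
  (loss D sigma x)%:E =
  (\int[lebesgue_measure]_s (exponential_pdf r s * lost D sigma (x, s))%:E)%E.
Proof.
move=> msigma; rewrite /loss /Rintegral fineK//.
exact: integrable_fin_num (integrable_lost D x msigma).
Qed.

(** Before passage [D] is at most the gain, so the reward of [tau] dominates the loss. *)
Let integrable_loss D sigma : measurable_fun [set: T] sigma -> 0 <= D ->
  (forall n, (n < k)%N -> D <= gain n) ->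
  P.-integrable setT (EFin \o loss D sigma).
Proof.
move=> msigma D0 Dgain; apply: le_integrable integrable_reward => //.
  rewrite (_ : _ \o _ = fubini_F lebesgue_measure
     (fun z => (exponential_pdf r z.2 * lost D sigma z)%:E)); last first.
    by apply/funext => x; exact: EFin_loss.
  apply: measurable_fun_fubini_tonelli_F => [|z]; last exact: weight_lost_ge0.
  apply/measurable_EFinP; apply: measurable_funM; last exact: measurable_lost.
  exact: (measurableT_comp (measurable_exponential_pdf r) measurable_snd).
move=> x _; rewrite /= !ger0_norm ?loss_ge0// lee_fin reward_stopped.
apply: le_Rintegral => //; first exact: integrable_lost.
move=> s _; apply: ler_wpM2l; first by rewrite exponential_pdf_ge0// ltW.
rewrite /lost /stopped; case: ltnP => Xk; rewrite ?andbF ?mulr0// andbT mulr1.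
by case: (_ < _)%E; rewrite ?mulr1 ?Dgain// mulr0 ltW// gain_gt0.
Qed.

Let le_expected_reward D sigma : measurable_fun [set: T] sigma -> 0 <= D ->
  (forall n, (n < k)%N -> D <= gain n) ->
  (expected_reward P r alpha c V sigma <=
   poisson_value%:E - \int[P]_x (loss D sigma x)%:E)%E.
Proof.
move=> msigma D0 Dgain.
rewrite -integral_reward -integralB_EFin//; last exact: integrable_loss.
rewrite /expected_reward unlock; apply: le_integral_nonmeasurable => x.
by rewrite -EFinB lee_fin lerBrDr le_reward.
Qed.

Let expected_reward_first_passage :
  expected_reward P r alpha c V tau = poisson_value%:E.
Proof. by rewrite /expected_reward unlock. Qed.

(** Dropping the nonnegative loss bounds every expected reward by that of first passage, which
    attains the bound. *)
Lemma stopping_value_poisson : stopping_value P r alpha c V = poisson_value%:E.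
Proof.
apply/eqP; rewrite eq_le; apply/andP; split.
  apply: ge_ereal_sup => _ [sigma stop <-].
  have msigma := measurable_stopping_time P_complete N_poisson stop.
  have [D D0 Dgain] := gain_min.
  apply: le_trans (le_expected_reward msigma (ltW D0) Dgain) _.
  rewrite leeBlDr; last first.
    exact: integrable_fin_num (integrable_loss msigma (ltW D0) Dgain).
  by rewrite leeDl// integral_ge0// => x _; rewrite lee_fin loss_ge0// ltW.
apply: ereal_sup_ubound; exists tau; last exact: expected_reward_first_passage.
exact: stopping_time_first_passage N_poisson levelP.
Qed.

Let loss_gt0 D sigma x : measurable_fun [set: T] sigma -> 0 < D ->
  (0 <= sigma x)%E -> (sigma x < tau x)%E -> 0 < loss D sigma x.
Proof.
move=> msigma D0.
case sE : (sigma x) => [s| |]//; last by move=> _; rewrite ltNge leey.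
rewrite lee_fin => s0 stau.
have := stau; rewrite (lt_first_passage N_poisson levelP)//.
move=> /(poisson_lt_right N_poisson s0)[u su Nuk].
have u0 : 0 <= u by apply: le_trans s0 (ltW su).
(* The discount decreases, so its value at [u] makes [m] a lower bound of the integrand on []s, u]],
   where fewer than [k] jumps have occurred. *)
pose m := D * (r * expR (- r * u)).
have m0 : 0 < m by rewrite !mulr_gt0// expR_gt0.
rewrite -lte_fin EFin_loss//.
apply: (@lt_le_trans _ _ (\int[lebesgue_measure]_(y in `]s, u]) m%:E)%E).
  rewrite integral_cst//= lebesgue_measure_itv/= lte_fin su -EFinB -EFinM lte_fin.
  by rewrite mulr_gt0// subr_gt0.
rewrite integral_mkcond; apply: ge0_le_integral => //.
- by move=> y _; rewrite patchE; case: ifP => // _; rewrite lee_fin ltW.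
- by apply/(measurable_restrictT _ _).1 => //.
- by have /integrableP[] := integrable_lost D x msigma.
move=> y _; rewrite patchE mem_setE; case: ifPn; last first.
  by move=> _; exact: (weight_lost_ge0 sigma (x, y) (ltW D0)).
rewrite in_itv/= => /andP[sy yu]; have y0 : 0 <= y by apply: le_trans s0 (ltW sy).
rewrite lee_fin exponential_pdfE// /lost /= sE lte_fin sy /X /= max_r//.
rewrite (leq_ltn_trans _ Nuk)/=; last exact: (poisson_nondecreasing N_poisson).
rewrite mulr1 /m mulrC ler_pM2r// ler_pM2l// ler_expR.
by rewrite !mulNr lerN2 ler_pM2l.
Qed.

Lemma smallest_optimal_first_passage :
  smallest_optimal_stopping_time P r alpha c V tau.
Proof.
split.
  split; first exact: stopping_time_first_passage N_poisson levelP.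
  by rewrite stopping_value_poisson expected_reward_first_passage.
move=> sigma [stop]; rewrite stopping_value_poisson => opt.
have msigma := measurable_stopping_time P_complete N_poisson stop.
have [D D0 Dgain] := gain_min.
have iL := integrable_loss msigma (ltW D0) Dgain.
(* Optimality gives [poisson_value <= poisson_value - E[loss]], with a finite nonnegative expected
   loss. *)
have L0 : (\int[P]_x (loss D sigma x)%:E = 0)%E.
  have := le_expected_reward msigma (ltW D0) Dgain; rewrite opt.
  have := integrable_fin_num measurableT iL.
  have : (0 <= \int[P]_x (loss D sigma x)%:E)%E.
    by apply: integral_ge0 => x _; rewrite lee_fin loss_ge0// ltW.
  case: (\int[P]_x _)%E => //= l; rewrite !lee_fin => l0 _.
  by rewrite lerBrDr gerDl => l0'; congr EFin; apply/eqP; rewrite eq_le l0 l0'.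
(* A nonnegative loss of mean zero vanishes almost surely, yet it is positive wherever
   [sigma < tau]. *)
have neg : P.-negligible [set x | (sigma x < tau x)%E].
  have [mL _] := integrableP _ _ _ iL.
  have [+ _] := ae_eq_integral_abs P measurableT mL.
  have -> : (\int[P]_x `|(EFin \o loss D sigma) x| = 0)%E.
    rewrite -[RHS]L0; apply: eq_integral => x _.
    by rewrite /= ger0_norm// loss_ge0// ltW.
  move=> /(_ erefl); apply: negligibleS => x /= st /(_ I) [] L.
  by have := loss_gt0 msigma D0 (stop.1 x) st; rewrite L ltxx.
have mneg := P_complete neg.
have -> : [set x | (tau x <= sigma x)%E] = ~` [set x | (sigma x < tau x)%E].
  by apply/seteqP; split => x /=; rewrite leNgt => /negP.
by rewrite probability_setC// (measure_negligible mneg neg) sube0.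
Qed.

End optimal_stopping_poisson.

(** * Closed forms of the level and the value *)

Lemma stopping_levelE (R : realType) (r alpha c a : R) :
  0 < r -> 0 < alpha -> 0 < a -> stopping_level r alpha c a = c / alpha.
Proof.
move=> r0 alpha0 a0; rewrite /stopping_level /psi1 expRN.
have e1 : 1 < expR 1 :> R by rewrite expR_gt1.
have e0 : 0 < expR 1 :> R by apply: expR_gt0.
(* As [e > 1], [e a] exceeds [a]; the factor to be cancelled is therefore nonzero. *)
have h : 0 < expR 1 * r + expR 1 * a - a.
  have := mulr_gt0 e0 r0; have : a < expR 1 * a by rewrite ltr_pMl.
  lra.
by field; rewrite !lt0r_neq0.
Qed.

Lemma expR_threshold (R : realType) (v B : R) : 0 < v -> 0 < B ->
  exists k, forall n, (v * expR (- n%:R) <= B) = (k <= n)%N.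
Proof.
move=> v0 B0.
have ex : exists n, v * expR (- n%:R) <= B.
  (* This [n] exceeds [v / B], and [e^n >= 1 + n]. *)
  exists (Num.truncn (v / B)).+1.
  rewrite expRN ler_pdivrMr ?expR_gt0// mulrC -ler_pdivrMr//.
  apply: le_trans (expR_ge1Dx _); apply: le_trans (ltW (truncnS_gt _)) _.
  by rewrite lerDr.
exists (ex_minn ex) => n; case: ex_minnP => m Bm minm.
apply/idP/idP => [/minm//|mn]; apply: le_trans Bm.
by rewrite ler_pM2l// ler_expR lerN2 ler_nat.
Qed.

(** Two geometric sums, with ratio [a / (e (r + a))] from the [alpha v e^-i] part of the gain and
    [a / (r + a)] from its constant part. *)
Lemma poisson_valueE (R : realType) (r alpha c a v : R) k :
  0 < r -> 0 < a -> poisson_value r alpha c a v k =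
  alpha * v / (r - psi1 a) * (1 - (a / (expR 1 * (r + a))) ^+ k)
   - c / r * (1 - (a / (r + a)) ^+ k).
Proof.
move=> r_gt0 a_gt0.
have e1 : 1 < expR 1 :> R by rewrite expR_gt1.
have e0 : 0 < expR 1 :> R by apply: expR_gt0.
have ra0 : 0 < r + a by rewrite addr_gt0.
have h : 0 < expR 1 * r + expR 1 * a - a.
  have := mulr_gt0 e0 r_gt0; have : a < expR 1 * a by rewrite ltr_pMl.
  lra.
rewrite /poisson_value /psi1 expRN.
elim: k => [|n IH]; first by rewrite big_ord0 !expr0; ring.
rewrite big_ord_recr /= IH !exprS expRN -(mulr1 n%:R) expRM_natl.
rewrite ![(a / _) ^+ n]exprMn !exprVn [(expR 1 * _) ^+ n]exprMn.
have := expf_neq0 n (lt0r_neq0 ra0); have := expf_neq0 n (lt0r_neq0 e0).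
move: (expR 1 ^+ n) ((r + a) ^+ n) (a ^+ n) => x1 x2 x3 x10 x20.
by field; rewrite x10 x20 !lt0r_neq0//; lra.
Qed.

Section value_series.
Variables (R : realType) (r alpha c a v : R) (k : nat).
Hypotheses (r_gt0 : 0 < r) (alpha_gt0 : 0 < alpha) (a_gt0 : 0 < a).
Hypothesis levelP : forall n : nat, (v * expR (- n%:R) <= c / alpha) = (k <= n)%N.

Lemma value_termE i : (0 < i)%N -> value_term r alpha c a v i =
  if i == k then poisson_value r alpha c a v k else 0.
Proof.
move=> i0; rewrite /value_term /= stopping_levelE//.
have bE n : (v <= c / alpha * expR 1 ^+ n) = (k <= n)%N.
  rewrite -levelP -[in RHS](mulr1 n%:R) expRN expRM_natl.
  by rewrite ler_pdivrMr ?exprn_gt0 ?expR_gt0.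
rewrite indicE (_ : (v \in _) = (i == k)).
  by case: eqP => [->|_]; rewrite ?mulr0// mulr1 poisson_valueE.
(* Since [0 < i], [i.-1] is a true predecessor, and the interval says [i - 1 < k <= i]. *)
rewrite mem_setE in_itv/= bE ltNge bE -ltnNge prednK//.
by rewrite eq_sym eqn_leq andbC.
Qed.

Lemma value_series : (0 < k)%N ->
  (\sum_(1 <= i <oo) (value_term r alpha c a v i)%:E =
   (poisson_value r alpha c a v k)%:E)%E.
Proof.
move=> k0; apply: lim_near_cst => //; near=> n.
(* Once [n > k] the partial sum contains its only nonzero term, of index [k]. *)
have kn : (k < n)%N by near: n; exists k.+1.
rewrite (bigD1_seq k) ?iota_uniq ?mem_index_iota ?k0//=.
rewrite value_termE// eqxx big_nat_cond big1 ?adde0// => i /andP[/andP[i0 _]].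
by rewrite value_termE// => /negbTE ->.
Unshelve. all: by end_near. Qed.

End value_series.

Theorem proposition4p8 (d : measure_display) (T : measurableType d)
    (R : realType) (P : probability T R) (P_complete : measure_is_complete P)
    (r alpha c a : R) (r_gt0 : 0 < r) (alpha_gt0 : 0 < alpha) (c_gt0 : 0 < c)
    (a_gt0 : 0 < a) (N : R -> T -> nat) (N_poisson : poisson_process P a N) :
  let V := exp_neg_poisson N in
  let w v := stopping_value P r alpha c (V v) in
  let B := stopping_level r alpha c a in
  (forall v, 0 < v ->
     smallest_optimal_stopping_time P r alpha c (V v)
       (first_passage_below (V v) B)) /\
  (forall v, 0 < v -> B < v ->
     w v = (\sum_(1 <= i <oo) (value_term r alpha c a v i)%:E)%E).
Proof.
move=> V w B; rewrite /B stopping_levelE//.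
have B_gt0 : 0 < c / alpha by rewrite divr_gt0.
split=> v v_gt0.
  have [k levelP] := expR_threshold v_gt0 B_gt0.
  exact: (smallest_optimal_first_passage P_complete N_poisson).
move=> Bv; have [k levelP] := expR_threshold v_gt0 B_gt0.
rewrite /w (stopping_value_poisson P_complete N_poisson _ _ _ _ _ levelP)//.
rewrite (value_series r_gt0 alpha_gt0 a_gt0 levelP)// lt0n.
(* [k = 0] would give [v <= B] at [n = 0]. *)
by apply/eqP => k0; have := levelP 0%N; rewrite k0 oppr0 expR0 mulr1 leNgt Bv.
Qed.
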